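(* Let $R$ be a valuation ring with maximal ideal $P$, and assume that $Z\neq 0$, where $Z$ is the set of zero-divisors of $R$. Then the following conditions are equivalent: (1) each product of content $R$-modules is content; (2) $R^R$ (the product of copies of $R$ indexed by the set $R$) is a content module; (3) for each ideal $A$ of $R$ there exists $a\in R$ such that either $A=Ra$ or $A=Pa$; (4) each ideal of $R$ is countably generated and $R^{\mathbb{N}}$ is a content module; (5) the intersection of any non-empty family of principal ideals of $R$ is finitely generated.
   Context: A valuation ring is a commutative ring $R$ (possibly with zero-divisors) whose set of ideals is totally ordered by inclusion. $Z=\{s\in R\mid \exists\, 0\ne x\in R,\ sx=0\}$, so $Z\ne 0$ means that $R$ is not a domain. For an $R$-module $M$ and $x\in M$, the content ideal $\mathrm{c}(x)$ is the intersection of all ideals $A$ of $R$ for which $x\in AM$; $M$ is a content module if $x\in\mathrm{c}(x)M$ for all $x\in M$. *)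

(* Defs.v *)
From HB Require Import structures.
From mathcomp Require Import all_boot all_order all_algebra.
From mathcomp Require Import boolp classical_sets functions cardinality.

Set Implicit Arguments.
Unset Strict Implicit.
Unset Printing Implicit Defensive.

Import GRing.Theory.

Local Open Scope ring_scope.
Local Open Scope classical_set_scope.

Section DirectProduct.
Variables (R : pzRingType) (I : Type) (M : I -> lmodType R).

(* The classical library only puts a module structure on non-dependent
   functions [T -> V]. *)
Definition dprodmod : Type := forall i, M i.

HB.instance Definition _ := gen_eqMixin dprodmod.
HB.instance Definition _ := gen_choiceMixin dprodmod.

Let dadd (f g : dprodmod) : dprodmod := fun i => f i + g i.
Let dzero : dprodmod := fun=> 0.
Let dopp (f : dprodmod) : dprodmod := fun i => - f i.
Let dscale (a : R) (f : dprodmod) : dprodmod := fun i => a *: f i.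

Fact dprodmod_addA : associative dadd.
Proof. by move=> f g h; apply: functional_extensionality_dep => i; exact: addrA. Qed.

Fact dprodmod_addC : commutative dadd.
Proof. by move=> f g; apply: functional_extensionality_dep => i; exact: addrC. Qed.

Fact dprodmod_add0 : left_id dzero dadd.
Proof. by move=> f; apply: functional_extensionality_dep => i; exact: add0r. Qed.

Fact dprodmod_addN : left_inverse dzero dopp dadd.
Proof. by move=> f; apply: functional_extensionality_dep => i; exact: addNr. Qed.

HB.instance Definition _ := GRing.isZmodule.Build dprodmod
  dprodmod_addA dprodmod_addC dprodmod_add0 dprodmod_addN.

Fact dprodmod_scaleA a b f : dscale a (dscale b f) = dscale (a * b) f.
Proof. by apply: functional_extensionality_dep => i; exact: scalerA. Qed.

Fact dprodmod_scale1 : left_id 1 dscale.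
Proof. by move=> f; apply: functional_extensionality_dep => i; exact: scale1r. Qed.

Fact dprodmod_scaleDr : right_distributive dscale +%R.
Proof. by move=> a f g; apply: functional_extensionality_dep => i; exact: scalerDr. Qed.

Fact dprodmod_scaleDl f : {morph dscale^~ f : a b / a + b}.
Proof. by move=> a b; apply: functional_extensionality_dep => i; exact: scalerDl. Qed.

HB.instance Definition _ := GRing.Zmodule_isLmodule.Build R dprodmod
  dprodmod_scaleA dprodmod_scale1 dprodmod_scaleDr dprodmod_scaleDl.

End DirectProduct.

Definition powmod (R : pzRingType) (I : Type) : lmodType R :=
  dprodmod (fun _ : I => (R^o : lmodType R)).

Definition submodule (R : pzRingType) (M : lmodType R) (N : set M) : Prop :=
  GRing.submod_closed [in N].

Definition submod_span (R : pzRingType) (M : lmodType R) (X : set M) : set M :=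
  smallest (@submodule R M) X.

Section Ideals.
Variable R : comNzRingType.
Implicit Types (A P X : set R).

(* The unit ideal is included. *)
Definition ideal A : Prop := @submodule R R^o A.

Definition ideal_span X : set R := @submod_span R R^o X.

Definition principal (a : R) : set R := [set r * a | r in [set: R]].

Definition ideal_mulr A (a : R) : set R := [set p * a | p in A].

Definition finitely_generated A : Prop :=
  exists2 X : set R, finite_set X & A = ideal_span X.

Definition countably_generated A : Prop :=
  exists2 X : set R, countable X & A = ideal_span X.

Definition maximal_ideal P : Prop :=
  [/\ ideal P, P <> [set: R] &
      forall A, ideal A -> P `<=` A -> A = P \/ A = [set: R]].

Definition valuation_ring : Prop :=
  forall A B : set R, ideal A -> ideal B -> A `<=` B \/ B `<=` A.

(* 0 belongs to this set. *)
Definition zero_divisors : set R :=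
  [set s | exists2 x : R, x <> 0 & s * x = 0].

(* The submodule AM, spanned by the products [a *: m]. *)
Definition ideal_mulmod A (M : lmodType R) : set M :=
  submod_span [set y | exists2 a, A a & exists m : M, y = a *: m].
Arguments ideal_mulmod : clear implicits.

Definition content (M : lmodType R) (x : M) : set R :=
  \bigcap_(A in [set A | ideal A /\ ideal_mulmod A M x]) A.

Definition content_module (M : lmodType R) : Prop :=
  forall x : M, ideal_mulmod (content x) M x.

End Ideals.

Arguments zero_divisors : clear implicits.
Arguments ideal_mulmod {R} A M.

(* Main.v *)
Require Import Defs.
From mathcomp Require Import all_boot all_order all_algebra.
From mathcomp Require Import boolp classical_sets functions cardinality.

(** In a valuation ring, [x] lies in [A M] iff [x = a m] with [a] in [A], so [M]
  is content iff every [x] can be written [a m] with [Ra] least among the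
  principal ideals [Rb] such that [x] lies in [bM].  For [M = R^I] and
  [x = (x_i)] this says that among the principal ideals containing all [x_i]
  there is a least one, [Ra]; then the ideal generated by the [x_i] can only be
  [Ra] or [Pa].  For (3) => (4), condition (3) together with a nonzero
  zero-divisor forces [P] to be nil: a non-nilpotent [q] in [P] would give a
  prime ideal [Q <> 0] avoiding [q] and contained in some [Ra] with [a] in [Q],
  whence [a] in [Q q], hence in [a P], and [a = 0].  If [P] is not principal,
  fix [p <> 0] in [P] and write [p] in [R c_n^n] with [c_n] in [P]; the [c_n]
  generate [P], since [q] in [P] outside all [R c_n] would divide every [c_n],
  and [p] would lie in every [R q^n]. *)

Import GRing.Theory.

Local Open Scope ring_scope.
Local Open Scope classical_set_scope.

Lemma submoduleP {R : pzRingType} {M : lmodType R} {N : set M} :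
  submodule N <-> N 0 /\ forall a u v, N u -> N v -> N (a *: u + v).
Proof.
split=> [[N0 NL]|[N0 NL]]; split.
- by rewrite inE in N0.
- by move=> a u v Nu Nv; have := NL a u v; rewrite !inE; apply.
- by rewrite inE.
- by move=> a u v; rewrite !inE; apply: NL.
Qed.

Lemma submod_span_submodule {R : pzRingType} {M : lmodType R} (X : set M) :
  submodule (submod_span X).
Proof.
apply/submoduleP; split=> [N [/submoduleP[]]//|a u v Xu Xv N NX].
by have /submoduleP[_] := NX.1; apply; [exact: Xu|exact: Xv].
Qed.

(** * Ideals of a commutative ring, with membership in [Ra] read as divisibility by [a] *)

Section Ideals.
Context {R : comNzRingType}.
Implicit Types (A P Q X : set R) (a b x : R).

Lemma idealP {A} :
  ideal A <-> A 0 /\ forall r x y, A x -> A y -> A (r * x + y).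
Proof. exact: (@submoduleP R R^o A). Qed.

Lemma ideal0 {A} : ideal A -> A 0.
Proof. by move=> /idealP[]. Qed.

Lemma idealMl {A} r {x} : ideal A -> A x -> A (r * x).
Proof. by move=> /idealP[A0 AL] Ax; rewrite -[r * x]addr0; apply: AL. Qed.

Lemma idealD {A x y} : ideal A -> A x -> A y -> A (x + y).
Proof. by move=> /idealP[_ AL] Ax Ay; rewrite -[x]mul1r; apply: AL. Qed.

Lemma principalP a x : principal a x <-> exists r, x = r * a.
Proof. by split=> [[r _ <-]|[r ->]]; exists r. Qed.

Lemma principal_refl a : principal a a.
Proof. by apply/principalP; exists 1; rewrite mul1r. Qed.

Lemma principal_ideal a : ideal (principal a).
Proof.
apply/idealP; split=> [|r x y]; first by apply/principalP; exists 0; rewrite mul0r.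
move=> /principalP[s ->] /principalP[t ->]; apply/principalP.
by exists (r * s + t); rewrite mulrDl mulrA.
Qed.

Lemma principal_sub {A a} : ideal A -> A a -> principal a `<=` A.
Proof. by move=> Ai Aa x /principalP[r ->]; apply: idealMl. Qed.

Lemma principal_trans {a b x} : principal a b -> principal b x -> principal a x.
Proof. by move=> ab; apply: (principal_sub (principal_ideal a) ab). Qed.

Lemma principal_mulr a x : principal x (a * x).
Proof. by apply/principalP; exists a. Qed.

Lemma principal0 x : principal 0 x -> x = 0.
Proof. by move=> /principalP[r ->]; rewrite mulr0. Qed.

Lemma principalM {a b x y} :
  principal a x -> principal b y -> principal (a * b) (x * y).
Proof.
move=> /principalP[r ->] /principalP[s ->]; apply/principalP.
by exists (r * s); rewrite mulrACA.
Qed.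

Lemma principalX {a x} n : principal a x -> principal (a ^+ n) (x ^+ n).
Proof.
move=> ax; elim: n => [|n IH]; first exact: principal_refl.
by rewrite !exprS; apply: principalM.
Qed.

Lemma ideal_span_ideal X : ideal (ideal_span X).
Proof. exact: (@submod_span_submodule R R^o X). Qed.

Lemma sub_ideal_span X : X `<=` ideal_span X.
Proof. exact: sub_gen_smallest. Qed.

Lemma ideal_span_sub {A X} : ideal A -> X `<=` A -> ideal_span X `<=` A.
Proof. exact: smallest_sub. Qed.

Lemma principal_finitely_generated a : finitely_generated (principal a).
Proof.
exists [set a]; first exact: finite_set1.
apply/seteqP; split.
- by apply: (principal_sub (ideal_span_ideal _)); apply: sub_ideal_span.
- by apply: (ideal_span_sub (principal_ideal a)) => _ ->; apply: principal_refl.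
Qed.

Lemma seq_countably_generated {A} (f : nat -> R) :
  ideal A -> (forall n, A (f n)) ->
  (forall x, A x -> exists n, principal (f n) x) -> countably_generated A.
Proof.
move=> Ai Af fA; exists (range f).
  exact: (sub_countable (card_image_le _ _) (countableP _)).
apply/seteqP; split=> [x /fA[n]|].
  by apply: (principal_sub (ideal_span_ideal _)); apply: sub_ideal_span; exists n.
by apply: (ideal_span_sub Ai) => _ [n _ <-].
Qed.

(** The value [0] pads the enumeration at indices that no element of [X] has, which also covers an
    empty [X]; it is harmless since every ideal contains [0]. *)
Lemma countable_enum X : countable X ->
  exists f : nat -> R, X `<=` range f /\ range f `<=` X `|` [set 0].
Proof.
move=> /countable_injP[g ginj].
have /choice[f fP] : forall n, exists y,
    (X `|` [set 0]) y /\ forall x, X x -> g x = n -> y = x.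
  move=> n; have [[y [Xy gy]]|ngn] := pselect (exists y, X y /\ g y = n).
    exists y; split=> [|x Xx gx]; first by left.
    by apply: ginj; rewrite ?inE// gy gx.
  by exists 0; split=> [|x Xx gx]; [right|case: ngn; exists x].
exists f; split=> [x Xx|_ [n _ <-]]; last by have [] := fP n.
by exists (g x) => //; have [_] := fP (g x); apply.
Qed.

Lemma zero_divisors_nontrivial : zero_divisors R <> [set 0] ->
  exists s t : R, [/\ s <> 0, t <> 0 & s * t = 0].
Proof.
move=> Z0; apply: contrapT => nst; apply: Z0; apply/seteqP; split=> [s [t t0 st]|_ ->].
  by apply: contrapT => s0; apply: nst; exists s, t.
by exists 1; [exact/eqP/oner_neq0|rewrite mul0r].
Qed.

(** The generator [a] need not lie in the ideal generated by [X], which leaves room for the shape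
    [Pa]. *)
Definition least_principal X a : Prop :=
  X `<=` principal a /\ forall b, X `<=` principal b -> principal b a.

End Ideals.

(** * Valuation rings and content modules over them *)

Section ValuationRing.
Context {R : comNzRingType} (valR : valuation_ring R).
Implicit Types (A Q X : set R) (a b x : R).

Lemma principal_total a b : principal a b \/ principal b a.
Proof.
have [ab|ba] := valR _ _ (principal_ideal a) (principal_ideal b).
- by right; apply: ab; apply: principal_refl.
- by left; apply: ba; apply: principal_refl.
Qed.

Lemma ideal_sub_principal {A a} : ideal A -> ~ A a -> A `<=` principal a.
Proof.
move=> Ai nAa x Ax; have [//|xa] := principal_total a x.
by case: nAa; apply: principal_sub xa.
Qed.

Lemma finitely_generated_principal {A} :
  finitely_generated A -> exists a, A = principal a.
Proof.
move=> [X /finite_seqP[s ->] ->].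
suff [a Aa sa] : exists2 a, ideal_span [set` s] a & [set` s] `<=` principal a.
  exists a; apply/seteqP; split.
  - exact: ideal_span_sub (principal_ideal a) sa.
  - exact: principal_sub (ideal_span_ideal _) Aa.
have : [set` s] `<=` ideal_span [set` s] by apply: sub_ideal_span.
(* The span becomes an arbitrary ideal containing the list, so that it stays fixed while the list
   shrinks in the induction. *)
have := ideal_span_ideal [set` s]; move: (ideal_span _) => A' A'i.
elim: s => [|y s IH] sA; first by exists 0; [exact: ideal0|].
have [|a A'a sa] := IH.
  by move=> x sx; apply: sA; rewrite /= inE sx orbT.
have A'y : A' y by apply: sA; rewrite /= mem_head.
have [ay|ya] := principal_total a y.
  by exists a => // x /=; rewrite inE => /orP[/eqP->//|/sa].
exists y => // x /=; rewrite inE => /orP[/eqP->|/sa ax].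
- exact: principal_refl.
- exact: principal_sub (principal_ideal y) ya _ ax.
Qed.

(** A sum of products by [a] and by [b] is a single product again, since one of [a], [b] divides the
    other. *)
Lemma ideal_mulmodP {A} {M : lmodType R} {x : M} : ideal A ->
  ideal_mulmod A M x <-> exists a, A a /\ exists m : M, x = a *: m.
Proof.
move=> Ai; split; last first.
  by move=> [a [Aa [m xam]]]; apply: sub_gen_smallest; exists a => //; exists m.
apply: (@smallest_sub _ _ _ [set x : M | exists a, A a /\ exists m, x = a *: m]).
  apply/submoduleP; split.
    by exists 0; split; [exact: ideal0|exists 0; rewrite scaler0].
  move=> c _ _ [a [Aa [m ->]]] [b [Ab [m' ->]]].
  have [/principalP[r ->]|/principalP[r ->]] := principal_total a b.
  - exists a; split=> //; exists (c *: m + r *: m').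
    by rewrite scalerDr !scalerA mulrC [a * r]mulrC.
  - exists b; split=> //; exists ((c * r) *: m + m').
    by rewrite scalerDr !scalerA mulrA [b * _]mulrC.
by move=> _ [a Aa [m ->]]; exists a; split=> //; exists m.
Qed.

Lemma content_ideal {M : lmodType R} (x : M) : ideal (content x).
Proof.
apply/idealP; split=> [A [Ai _]|r y z Cy Cz A xA]; first exact: ideal0.
by have /idealP[_] := xA.1; apply; [exact: Cy|exact: Cz].
Qed.

Lemma content_moduleP {M : lmodType R} : content_module M <->
  forall x : M, exists a, (exists m : M, x = a *: m) /\
    forall b (m : M), x = b *: m -> principal b a.
Proof.
split=> [cM x|cM x].
  have /(ideal_mulmodP (content_ideal x))[a [ca xam]] := cM x.
  exists a; split=> // b m xbm; apply: ca; split; first exact: principal_ideal.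
  apply/(ideal_mulmodP (principal_ideal b)).
  by exists b; split; [exact: principal_refl|exists m].
have [a [xam amin]] := cM x.
apply/(ideal_mulmodP (content_ideal x)); exists a; split=> // A [Ai].
by move=> /(ideal_mulmodP Ai)[b [Ab [m /amin]]]; apply: principal_sub.
Qed.

Lemma powmod_contentP {I : Type} : content_module (powmod R I) <->
  forall f : I -> R, exists a, least_principal (range f) a.
Proof.
have divE (f : I -> R) a : (exists m : powmod R I, (f : powmod R I) = a *: m) <->
    range f `<=` principal a.
  split=> [[m fam] _ [i _ <-]|fa].
    by apply/principalP; exists (m i); rewrite fam mulrC.
  have /choice[m fm] : forall i, exists r, f i = r * a.
    by move=> i; apply/principalP; apply: fa; exists i.
  exists (m : powmod R I).
  apply: (@functional_extensionality_dep I (fun=> R)) => i.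
  by rewrite fm; exact: (mulrC (m i) a).
split=> [/content_moduleP cM f|cf].
  have [a [/divE fa amin]] := cM f; exists a; split=> // b /divE[m].
  exact: amin.
apply/content_moduleP => f; have [a [/divE fa amin]] := cf f.
by exists a; split=> // b m fbm; apply: amin; apply/divE; exists m.
Qed.

(** An element [b] divides [x] iff it divides a content generator [c i] of every coordinate, so a
    generator of the intersection of all such [Rb] is the coefficient sought. *)
Lemma dprodmod_content :
  (forall F : set (set R), F !=set0 -> F `<=` range (@principal R) ->
     finitely_generated (\bigcap_(A in F) A)) ->
  forall (I : Type) (M : I -> lmodType R),
    (forall i, content_module (M i)) -> content_module (dprodmod M).
Proof.
move=> fgI I M cM; apply/content_moduleP => x.
have /choice[c cP] : forall i, exists a, (exists m : M i, x i = a *: m) /\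
    forall b (m : M i), x i = b *: m -> principal b a.
  by move=> i; have /content_moduleP := cM i; apply.
have divE b : (exists m : dprodmod M, x = b *: m) <-> range c `<=` principal b.
  split=> [[m xbm] _ [i _ <-]|cb].
    by have [_] := cP i; apply; rewrite xbm.
  have xb i : exists m : M i, x i = b *: m.
    have [[m ->] _] := cP i.
    have /principalP[r ->] : principal b (c i) by apply: cb; exists i.
    by exists (r *: m); rewrite scalerA mulrC.
  exists (fun i => projT1 (cid (xb i))).
  apply: functional_extensionality_dep => i.
  exact: projT2 (cid (xb i)).
pose F := [set principal b | b in [set b | range c `<=` principal b]].
have [|_ [b _ <-]|a FE] := finitely_generated_principal (fgI F _ _).
- exists (principal 1), 1 => // r _; apply/principalP; exists r.
  by rewrite mulr1.
- by exists b.
have aF : (\bigcap_(A in F) A) a by rewrite FE; apply: principal_refl.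
exists a; split=> [|b m xbm].
  apply/divE => r cr; rewrite -FE => _ [b cb <-]; exact: cb.
by apply: aF; exists b => //; apply/divE; exists m.
Qed.

(** The least [Ra] containing a sequence that generates the intersection [B] contains [B], and by
    minimality it lies in every member of [F]; hence it equals [B]. *)
Lemma content_powmod_bigcap_finitely_generated :
  (forall A : set R, ideal A -> countably_generated A) ->
  content_module (powmod R nat) ->
  forall F : set (set R), F `<=` range (@principal R) ->
    finitely_generated (\bigcap_(A in F) A).
Proof.
move=> cg /powmod_contentP cRN F Fp; set B := \bigcap_(A in F) A.
have Bi : ideal B.
  apply/idealP; split=> [A /Fp[a _ <-]|r x y Bx By A FA].
    exact: ideal0 (principal_ideal a).
  have [a _ aA] := Fp A FA; have /idealP[_] : ideal A.
    by rewrite -aA; apply: principal_ideal.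
  by apply; [exact: Bx|exact: By].
have [X /countable_enum[f [Xf fX]] BX] := cg B Bi.
have [a [fa amin]] := cRN f.
suff -> : B = principal a by apply: principal_finitely_generated.
apply/seteqP; split.
  rewrite BX; apply: ideal_span_sub (principal_ideal a) _.
  by move=> x /Xf/fa.
apply: (principal_sub Bi) => A FA; have [b _ bA] := Fp A FA.
rewrite -bA; apply: amin => x /fX[Xx|->].
  have : B x by rewrite BX; apply: sub_ideal_span.
  by rewrite bA; apply.
exact: ideal0 (principal_ideal b).
Qed.

(** * The maximal ideal: the shapes [Ra] and [Pa], nilpotency, countable generation *)

Section MaximalIdeal.
Context {P : set R} (maxP : maximal_ideal P).

Lemma notin_maximal_unit u : ~ P u -> exists v, v * u = 1.
Proof.
have [Pi _ Pmax] := maxP; move=> nPu.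
have [E|E] := Pmax _ (principal_ideal u) (ideal_sub_principal Pi nPu).
  by case: nPu; rewrite -E; apply: principal_refl.
have /principalP[v v1] : principal u 1 by rewrite E.
by exists v.
Qed.

Lemma maximal_not1 : ~ P 1.
Proof.
have [Pi PT _] := maxP; move=> P1; apply: PT; apply/seteqP; split=> // x _.
by rewrite -[x]mulr1; apply: idealMl.
Qed.

(** The element [1 - p] kills [a], and it is a unit, as otherwise [1] would lie in [P]. *)
Lemma maximal_fix0 {p a} : P p -> a = p * a -> a = 0.
Proof.
have [Pi _ _] := maxP; move=> Pp apa.
have [|v vp] := @notin_maximal_unit (1 - p).
  by move=> /(idealD Pi Pp); rewrite subrKC; exact: maximal_not1.
by rewrite -[a]mul1r -vp -mulrA mulrBl mul1r -apa subrr mulr0.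
Qed.

Lemma notin_ideal_mulr {a b} : principal a b -> ~ ideal_mulr P a b ->
  principal b a.
Proof.
move=> /principalP[r ->] nPab; have [|v vr] := @notin_maximal_unit r.
  by move=> Pr; apply: nPab; exists r.
by apply/principalP; exists v; rewrite mulrA vr mul1r.
Qed.

Lemma least_principal_shape {A a} : ideal A -> least_principal A a ->
  A = principal a \/ A = ideal_mulr P a.
Proof.
move=> Ai [Aa amin]; have [Aa'|nAa] := pselect (A a).
  by left; apply/seteqP; split=> //; apply: principal_sub.
(* An element of [A] outside [Pa] would be a unit multiple of [a], putting [a] in [A]. *)
right; apply/seteqP; split=> [x Ax|x Px].
  apply: contrapT => /(notin_ideal_mulr (Aa x Ax)) xa.
  exact/nAa/(principal_sub Ai Ax).
(* Now [A] lies in [Rx] with [x = p a], so minimality puts [a] in [R p a]; this forces [a = 0],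
   which lies in [A]. *)
apply: contrapT => nAx.
have /principalP[r ar] := amin x (ideal_sub_principal Ai nAx).
move: Px ar => [p Pp <-]; rewrite mulrA => ar; have [Pi _ _] := maxP.
by apply: nAa; rewrite (maximal_fix0 (idealMl r Pi Pp) ar); apply: ideal0.
Qed.

Lemma exists_least_principal {A a} : A = principal a \/ A = ideal_mulr P a ->
  exists b, least_principal A b.
Proof.
move=> [->|->].
  by exists a; split=> // b; apply; apply: principal_refl.
(* If some [Rb] contains [Pa] but not [a], then [b] lies in [Pa], as otherwise it would be a unit
   multiple of [a]; so [Pa = Rb]. If there is no such [b], then [a] itself is least. *)
have [[b [Pb nba]]|nb] := pselect
    (exists b, ideal_mulr P a `<=` principal b /\ ~ principal b a).
  exists b; split=> // c Pc; apply: Pc; apply: contrapT => nPab.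
  apply: (nba); apply: notin_ideal_mulr nPab.
  by have [|/nba] := principal_total a b.
exists a; split=> [_ [p Pp <-]|b Pb]; first by apply/principalP; exists p.
by apply: contrapT => nba; apply: nb; exists b.
Qed.

Lemma maximal_nil : zero_divisors R <> [set 0] ->
  (forall A, ideal A -> exists a, A = principal a \/ A = ideal_mulr P a) ->
  forall q, P q -> exists n, q ^+ n = 0.
Proof.
have [Pi _ _] := maxP; move=> /zero_divisors_nontrivial[s [t [s0 t0 st0]]] shape q Pq.
(* [Q] collects the elements dividing no power of [q]; it contains [0] because no power of [q]
   vanishes. *)
apply: contrapT => qn; pose Q := [set x | forall n, ~ principal x (q ^+ n)].
have Qi : ideal Q.
  apply/idealP; split=> [n /principal0 qn0|r x y Qx Qy n]; first by apply: qn; exists n.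
  (* Whichever of [x], [y] divides the other also divides [r * x + y]. *)
  have [xy|yx] := principal_total x y => xyq.
    apply: (Qx n); apply: principal_trans xyq.
    exact: idealD (principal_ideal x) (principal_mulr _ _) xy.
  apply: (Qy n); apply: principal_trans xyq.
  apply: idealD (principal_ideal y) _ (principal_refl y).
  exact: idealMl (principal_ideal y) yx.
have [a [Qa Qsub]] : exists a, Q a /\ Q `<=` principal a.
  have [a [E|E]] := shape Q Qi; exists a; rewrite [X in X `<=` _]E; split=> //.
  - by rewrite E; apply: principal_refl.
  (* Case [Q = Pa]: if [a] divided [q ^+ n], then [q ^+ n.+1] would lie in [Pa = Q], although it
     divides itself. *)
  - move=> n /principalP[r qra].
    suff : Q (q ^+ n.+1) by move=> /(_ n.+1); apply; apply: principal_refl.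
    by rewrite E; exists (r * q); [exact: idealMl|rewrite exprS qra mulrCA mulrA].
  - by move=> _ [p _ <-]; apply: principal_mulr.
(* Since [a] does not divide [q], [a = r q]. If [r] divided [q ^+ n], then [a] would divide
   [q ^+ n.+1]; so [r] is in [Q], [r = u a] and [a = u q a]. *)
have a0 : a = 0.
  have /principalP[r ar] : principal q a.
    by have [//|/(Qa 1%N)] := principal_total q a.
  have /Qsub/principalP[u ru] : Q r.
    move=> n rq; apply: (Qa n.+1); rewrite ar exprSr.
    exact: principalM rq (principal_refl q).
  by apply: (maximal_fix0 (idealMl u Pi Pq)); rewrite mulrAC -ru.
(* As [Q] is now zero, both nonzero factors of [s * t = 0] divide powers of [q], so a power of [q]
   vanishes after all. *)
have divq x : x <> 0 -> exists n, principal x (q ^+ n).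
  move=> x0; apply: contrapT => nxq; apply: x0.
  suff /Qsub : Q x by rewrite a0 => /principal0.
  by move=> n xq; apply: nxq; exists n.
have [[m sq] [n tq]] := (divq s s0, divq t t0).
apply: qn; exists (m + n)%N; rewrite exprD; apply: principal0.
by rewrite -st0; apply: principalM.
Qed.

Lemma maximal_power_divisor : (forall p, P <> principal p) ->
  forall p, P p -> forall n, exists c, P c /\ principal (c ^+ n.+1) p.
Proof.
have [Pi _ _] := maxP; move=> Pnp.
(* Since [p] does not generate [P], it factors as [r p'] with both factors in [P]; the one dividing
   the other has its square dividing [p]. *)
have sq p : P p -> exists c, P c /\ principal (c ^+ 2) p.
  move=> Pp; have [p' [Pp' npp']] : exists p', P p' /\ ~ principal p p'.
    apply: contrapT => np; apply: (Pnp p); apply/seteqP; split.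
      by move=> x Px; apply: contrapT => npx; apply: np; exists x.
    exact: principal_sub.
  have /principalP[r pr] : principal p' p.
    by have [/npp'|] := principal_total p p'.
  have Pr : P r.
    apply: contrapT => /notin_maximal_unit[v vr]; apply: npp'.
    by apply/principalP; exists v; rewrite pr mulrA vr mul1r.
  have [rp'|p'r] := principal_total r p'; rewrite pr.
    by exists r; split=> //; rewrite expr2; apply: principalM (principal_refl r) rp'.
  by exists p'; split=> //; rewrite expr2; apply: principalM p'r (principal_refl p').
move=> p Pp; elim=> [|n [c [Pc cp]]].
  by exists p; split=> //; apply: principal_refl.
have [d [Pd dc]] := sq c Pc; exists d; split=> //.
apply: principal_trans cp; apply: principal_trans (principalX n.+1 dc).
(* The exponent [2(n+1)] is at least the required [n+2]. *)
have -> : (d ^+ 2) ^+ n.+1 = d ^+ n * d ^+ n.+2.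
  by rewrite -exprM mul2n -addnn addSnnS exprD.
exact: principal_mulr.
Qed.

Lemma maximal_enum : (forall q, P q -> exists n, q ^+ n = 0) ->
  exists c : nat -> R,
    (forall n, P (c n)) /\ forall q, P q -> exists n, principal (c n) q.
Proof.
have [Pi _ _] := maxP; move=> Pnil.
have [[p Pp]|Pnp] := pselect (exists p, P = principal p).
  exists (fun=> p); rewrite Pp; split=> [_|q pq]; first exact: principal_refl.
  by exists 0%N.
have {}Pnp p : P <> principal p by move=> Pp; apply: Pnp; exists p.
have [p [Pp p0]] : exists p, P p /\ p <> 0.
  apply: contrapT => np; apply: (Pnp 0); apply/seteqP; split.
    move=> x Px; have [->|x0] := pselect (x = 0); first exact: principal_refl.
    by case: np; exists x.
  exact: principal_sub (ideal0 Pi).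
have /choice[c cP] := maximal_power_divisor Pnp p Pp.
exists c; split=> [n|q Pq]; first by have [] := cP n.
(* The nilpotency exponent of [q] serves as the index into [c]. *)
apply: contrapT => ncq; have [n qn] := Pnil q Pq.
have qc : principal q (c n).
  have [//|cq] := principal_total q (c n).
  by case: ncq; exists n.
apply: p0; apply: principal0; have [_] := cP n; apply: principal_trans.
by have := principalX n.+1 qc; rewrite exprS qn mulr0.
Qed.

End MaximalIdeal.

End ValuationRing.

Theorem theorem5p1 (R : comNzRingType) (P : set R)
    (valR : valuation_ring R) (maxP : maximal_ideal P)
    (Zneq0 : zero_divisors R <> [set 0]) :
  [<-> (* 1 *)
       forall (I : Type) (M : I -> lmodType R),
         (forall i : I, content_module (M i)) -> content_module (dprodmod M);
       (* 2 *)
       content_module (powmod R R);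
       (* 3 *)
       forall A : set R, ideal A ->
         exists a : R, A = principal a \/ A = ideal_mulr P a;
       (* 4 *)
       (forall A : set R, ideal A -> countably_generated A) /\
         content_module (powmod R nat);
       (* 5 *)
       forall F : set (set R), F !=set0 -> F `<=` range (@principal R) ->
         finitely_generated (\bigcap_(A in F) A)].
Proof.
tfae.
(* It suffices that [R] is content over itself: [x = x * 1], and [x = b m] puts [x] in [Rb]. *)
- apply=> _; apply/(content_moduleP valR) => x; exists x; split.
    by exists 1; apply/esym/mulr1.
  by move=> b m ->; apply/principalP; exists m; apply: mulrC.
- move=> /(powmod_contentP valR) cRR A Ai.
  (* The family lists [A] indexed by [R] itself; the default [0] adds no condition on a principal
     ideal. *)
  have [a [Aa amin]] := cRR (fun x => if `[< A x >] then x else 0).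
  exists a; apply: (least_principal_shape valR maxP Ai); split=> [x Ax|b Ab].
    by apply: Aa; exists x => //; case: asboolP.
  apply: amin => _ [x _ <-]; case: asboolP => [/Ab//|_].
  exact: ideal0 (principal_ideal b).
- move=> shape; have Pnil := maximal_nil valR maxP Zneq0 shape; split=> [A Ai|].
    have [a [E|E]] := shape A Ai.
      apply: (seq_countably_generated (fun=> a) Ai); rewrite E.
        by move=> _; apply: principal_refl.
      by move=> x ax; exists 0%N.
    have [c [Pc cP]] := maximal_enum valR maxP Pnil.
    apply: (seq_countably_generated (fun n => c n * a) Ai); rewrite E.
      by move=> n; exists (c n).
    move=> _ [p /cP[n cp] <-]; exists n.
    exact: principalM cp (principal_refl a).
  apply/(powmod_contentP valR) => f.
  (* The values of [f] and the ideal they span lie in the same principal ideals. *)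
  have [a aE] := shape _ (ideal_span_ideal (range f)).
  have [b [fb bmin]] := exists_least_principal valR maxP aE.
  exists b; split=> [x fx|d fd]; first by apply: fb; apply: sub_ideal_span.
  by apply: bmin; apply: ideal_span_sub (principal_ideal d) fd.
- move=> [cg cRN] F _; exact: (content_powmod_bigcap_finitely_generated valR).
- exact: (dprodmod_content valR).
Qed.
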